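(* Let $a,h>0$ and consider the Gaussian random energy model with external field: for each $N\ge1$ let $\xi_\sigma$, $\sigma\in\{+1,-1\}^N$, be i.i.d. $\mathcal{N}(0,\frac1N)$ random variables (all $N$ on one probability space), let $H_N(\sigma)=aN\xi_\sigma+h\sum_{i=1}^N\sigma_i$ and $Z_N(\beta,h)=\sum_{\sigma}e^{-\beta H_N(\sigma)}$, $\beta>0$. Let $$\mathcal{I}_0(y)=y\tanh^{-1}y-\log\cosh(\tanh^{-1}y)=\frac{1+y}2\log(1+y)+\frac{1-y}2\log(1-y),$$ extended to $y=1$ by $\mathcal{I}_0(1)=\log2$. Let $y_0$ be the non-negative solution of $\dfrac{a\tanh^{-1}(y)}{\sqrt{2[\log2-\mathcal{I}_0(y)]}}=h$, let $x_0=\dfrac{a\tanh^{-1}y_0}h$, and, for $\beta\le\frac1a\sqrt{2\log2}$, let $c_\beta\in[0,1]$ be the solution of $\mathcal{I}_0(c_\beta)=\log2-\frac12\beta^2a^2$. Then the limiting free energy $\mathcal{E}(\beta,h)=\lim_{N\to\infty}\frac1N\log Z_N(\beta,h)$ exists almost surely and is given by $$\mathcal{E}(\beta,h)=\begin{cases}\log2+\frac{\beta^2a^2}2+\log\cosh(\beta h)&\text{if }\beta\le\frac1a\sqrt{2\log2}\text{ and }y_0\le c_\beta,\\ \beta\left(ax_0+hy_0\right)&\text{otherwise.}\end{cases}$$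
   Context: ''Otherwise'' consists of the cases $\beta\le\frac1a\sqrt{2\log2}$ with $y_0>c_\beta$, and $\beta>\frac1a\sqrt{2\log2}$. *)

(* Defs.v *)
From HB Require Import structures.
From mathcomp Require Import all_boot all_order all_algebra.
From mathcomp Require Import all_classical all_reals all_analysis.
From mathcomp Require Import ring lra.

Set Implicit Arguments.
Unset Strict Implicit.
Unset Printing Implicit Defensive.

Import Order.TTheory GRing.Theory Num.Theory.
Import numFieldNormedType.Exports.

Local Open Scope classical_set_scope.
Local Open Scope ring_scope.

Section hyperbolic.
Context {R : realType}.
Implicit Types x y : R.

Definition cosh x : R := (expR x + expR (- x)) / 2.
Definition sinh x : R := (expR x - expR (- x)) / 2.
Definition tanh x : R := sinh x / cosh x.

(* Meaningful for -1 < y < 1 only; see artanhK and tanhK. *)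
Definition artanh y : R := ln ((1 + y) / (1 - y)) / 2.

Lemma cosh_gt0 x : 0 < cosh x.
Proof. by rewrite divr_gt0// addr_gt0 ?expR_gt0. Qed.

Lemma tanhK : cancel tanh artanh.
Proof.
move=> x; rewrite /artanh /tanh /sinh /cosh.
have := expR_gt0 x; have := expR_gt0 (- x).
have : expR x = expR (- x) * expR (x *+ 2).
  by rewrite -expRD; congr expR; ring.
set u := expR x; set v := expR (- x); set w := expR (x *+ 2) => uE v0 u0.
have -> : (1 + (u - v) / 2 / ((u + v) / 2)) / (1 - (u - v) / 2 / ((u + v) / 2))
    = u / v.
  by field; rewrite !gt_eqF//; lra.
by rewrite uE mulrAC divff ?gt_eqF// mul1r /w expRK; field.
Qed.

Lemma expR_artanh y : -1 < y < 1 -> expR (artanh y) ^+ 2 = (1 + y) / (1 - y).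
Proof.
move=> /andP[y1 y2]; rewrite -expRM_natl.
rewrite (_ : 2%:R * artanh y = ln ((1 + y) / (1 - y))); last first.
  by rewrite /artanh; field.
by rewrite lnK// posrE divr_gt0//; lra.
Qed.

Lemma artanhK y : -1 < y < 1 -> tanh (artanh y) = y.
Proof.
move=> y11; have /andP[y1 y2] := y11; have := expR_artanh y11.
rewrite /tanh /sinh /cosh expRN; have := expR_gt0 (artanh y).
set u := expR _ => u0 u2.
have -> : (u - u^-1) / 2 / ((u + u^-1) / 2) = (u ^+ 2 - 1) / (u ^+ 2 + 1).
  have u20 : 0 < u ^+ 2 by rewrite exprn_gt0.
  by field; rewrite !gt_eqF//=; lra.
by rewrite u2; field; rewrite !gt_eqF//; lra.
Qed.

End hyperbolic.

(* Only used on [0, 1]. *)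
Definition I0 {R : realType} (y : R) : R :=
  if y == 1 then ln 2 else y * artanh y - ln (cosh (artanh y)).

Lemma I0_entropy {R : realType} (y : R) : -1 < y <= 1 ->
  I0 y = (1 + y) / 2 * ln (1 + y) + (1 - y) / 2 * ln (1 - y).
Proof.
rewrite /I0 => /andP[y1 y2]; case: eqVneq => [->|yn1].
  by rewrite subrr mul0r mul0r addr0 -[1 + 1]/(2) divff// mul1r.
have y3 : y < 1 by rewrite lt_neqAle yn1.
have y11 : -1 < y < 1 by rewrite y1.
have := expR_artanh y11; have eu := expRK (artanh y).
have lE : artanh y = (ln (1 + y) - ln (1 - y)) / 2.
  by rewrite /artanh ln_div// posrE; lra.
have u0 := expR_gt0 (artanh y).
rewrite /cosh expRN; set u := expR (artanh y) in u0 eu * => u2.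
have -> : (u + u^-1) / 2 = ((1 - y) * u)^-1.
  have -> : (u + u^-1) / 2 = (u ^+ 2 + 1) / 2 / u.
    by field; rewrite gt_eqF.
  rewrite u2; field; rewrite !gt_eqF//; lra.
rewrite lnV ?posrE; last by rewrite mulr_gt0//; lra.
rewrite lnM ?posrE//; last by lra.
by rewrite eu lE; field.
Qed.

Section random_variables.
Context {d : measure_display} {T : measurableType d} {R : realType}.
Variable P : probability T R.
Local Open Scope ereal_scope.

Definition mutually_independent (I : finType) (X : I -> {RV P >-> R}) : Prop :=
  forall (J : {set I}) (B : I -> set R), (forall i, measurable (B i)) ->
    P (\bigcap_(i in [set` J]) X i @^-1` B i) =
    \prod_(i in J) P (X i @^-1` B i).

(* normal_prob takes the standard deviation, not the variance. *)
Definition iid_normal (I : finType) (m v : R) (X : I -> {RV P >-> R}) : Prop :=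
  mutually_independent X /\
  forall i (B : set R), measurable B ->
    distribution P (X i) B = normal_prob m (Num.sqrt v) B.

End random_variables.

(* Configurations in {+1, -1}^N are encoded as {ffun 'I_N -> bool}, the
   boolean b standing for the spin (-1)^b. *)
Definition config (N : nat) : finType := {ffun 'I_N -> bool}.

Section rem.
Context {R : realType}.
Implicit Types a h beta y c : R.

Definition spin (N : nat) (s : config N) (i : 'I_N) : R := (-1) ^+ s i.

Definition hamiltonian a h (N : nat) (x : config N -> R) (s : config N) : R :=
  a * N%:R * x s + h * \sum_(i < N) spin s i.

Definition partition_function a h (N : nat) (x : config N -> R) beta : R :=
  \sum_(s : config N) expR (- (beta * hamiltonian a h x s)).

(* The equation degenerates at y = 1, which is therefore excluded. *)
Definition is_y0 a h y : Prop :=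
  0 <= y < 1 /\ a * artanh y / Num.sqrt (2 * (ln 2 - I0 y)) = h.

Definition is_cbeta a beta c : Prop :=
  0 <= c <= 1 /\ I0 c = ln 2 - beta ^+ 2 * a ^+ 2 / 2.

Definition beta_threshold a : R := a^-1 * Num.sqrt (2 * ln 2).

(* c is irrelevant when beta exceeds beta_threshold a. *)
Definition limiting_free_energy a h beta y0 c : R :=
  let x0 := a * artanh y0 / h in
  if (beta <= beta_threshold a) && (y0 <= c)
  then ln 2 + beta ^+ 2 * a ^+ 2 / 2 + ln (cosh (beta * h))
  else beta * (a * x0 + h * y0).

End rem.

(* Main.v *)
Require Import Defs.
From HB Require Import structures.
From mathcomp Require Import all_boot all_order all_algebra.
From mathcomp Require Import all_classical all_reals all_analysis.
From mathcomp Require Import measurable_realfun ring lra.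

(** The free energy is driven by its annealed approximation
    [f b = ln 2 + b^2 a^2 / 2 + ln cosh (b h)], the exponential rate of
    [E Z_N(b)]. Let [bc] be the point where the tangent to [f] passes through
    the origin, [bc * f' bc = f bc]. By Legendre duality this is the equation
    [bc^2 a^2 / 2 + I0 (tanh (bc h)) = ln 2], so that [y0 = tanh (bc h)],
    [x0 = a bc] and [a x0 + h y0 = f' bc]; moreover the first case of the
    formula is exactly [beta <= bc] ([limiting_free_energyE]). What has to be
    shown is thus that the limit is [f beta] for [beta <= bc] and continues
    along the tangent line [beta * f' bc] beyond: the system freezes at [bc].

    Upper bounds. Markov's inequality and Borel-Cantelli give
    [limsup <= f b] at every [b] ([free_energy_upper]). Beyond [bc],
    [Z_N(beta) <= Z_N(bc) ^ (beta / bc)] gives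
    [limsup <= (beta / bc) f bc = beta f' bc].

    Lower bound for [b < bc]. The second moment of [Z_N] is too large in part
    of this range, but a [p]-th moment with [p] close to [1] suffices. As the
    Boltzmann weights [X_s] are independent and
    [exp (- x) <= 1 - x + x ^ p] for [1 <= p <= 2],
    [E exp (- k Z_N) <= exp (- k E Z_N + k ^ p E (sum_s X_s ^ p))],
    where the last mean is [E Z_N(p b)], of rate [f (p b)]. It is negligible
    against [(E Z_N) ^ p] when [f (p b) < p f b], i.e. when [f b / b]
    decreases from [b] to [p b]; this holds up to [bc], the minimizer of
    [f b / b]. Hence [Z_N >= exp (- N e) E Z_N] outside an event of
    exponentially small probability ([partition_function_lower_tail],
    [free_energy_lower]).

    Lower bound for [beta >= bc]. [ln Z_N] is convex, so it lies above the
    chords through points just below [bc], which converge to the tangent line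
    of [f] at [bc] ([free_energy_lower_frozen]).

    Convexity of [f], monotonicity of [I0] and the uniqueness claims all
    follow from one strict tangent inequality for [ln cosh]
    ([ln_cosh_tangent]). *)

Set Implicit Arguments.
Unset Strict Implicit.
Unset Printing Implicit Defensive.

Import Order.TTheory GRing.Theory Num.Theory.
Import numFieldNormedType.Exports.

Local Open Scope classical_set_scope.
Local Open Scope ring_scope.

(** * Hyperbolic functions and the rate function *)

Section log_cosh.
Context {R : realType}.
Implicit Types t u v w y : R.

Lemma cosh0 : cosh (0 : R) = 1.
Proof. by rewrite /cosh oppr0 expR0; field. Qed.

Lemma tanh0 : tanh (0 : R) = 0.
Proof. by rewrite /tanh /sinh oppr0 expR0 subrr !mul0r. Qed.

Lemma tanh_bound u : -1 < tanh u < 1.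
Proof.
have c0 := cosh_gt0 u; have e1 := expR_gt0 u; have e2 := expR_gt0 (- u).
rewrite /tanh ltr_pdivlMr// ltr_pdivrMr// /sinh /cosh; lra.
Qed.

(** Strict Jensen inequality for exp under the law of a sign with mean [t]:
    average the tangent bound [exp x > exp (t w) (1 + x - t w)] over
    [x = w, - w]. *)
Lemma two_point_jensen t w : -1 < t < 1 -> w != 0 ->
  expR (t * w) < (1 + t) / 2 * expR w + (1 - t) / 2 * expR (- w).
Proof.
move=> /andP[t1 t2] w0.
have E x : expR x = expR (t * w) * expR (x - t * w).
  by rewrite -expRD; congr expR; ring.
have P1 : 1 + (w - t * w) < expR (w - t * w).
  by apply: expR_gt1Dx; rewrite -[X in X - _]mul1r -mulrBl mulf_neq0//; lra.
have P2 : 1 + (- w - t * w) < expR (- w - t * w).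
  apply: expR_gt1Dx.
  by rewrite (_ : - w - t * w = - (1 + t) * w); [rewrite mulf_neq0//; lra|ring].
have e0 := expR_gt0 (t * w).
rewrite (E w) (E (- w)) mulrCA [X in _ < _ + X]mulrCA -mulrDr ltr_pMr//.
have : 0 < (1 + t) / 2 * (expR (w - t * w) - (1 + (w - t * w))).
  by rewrite mulr_gt0//; lra.
have : 0 < (1 - t) / 2 * (expR (- w - t * w) - (1 + (- w - t * w))).
  by rewrite mulr_gt0//; lra.
lra.
Qed.

(** Strict convexity of [ln cosh], whose derivative is [tanh]: the ratio
    [cosh v / cosh u] is the mean of [exp (+- (v - u))] under the sign of mean
    [tanh u]. The strict monotonicity of [tanh] and of [I0], and the convexity
    of the annealed free energy, follow without computing derivatives. *)
Lemma ln_cosh_tangent u v : u != v ->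
  ln (cosh u) + (v - u) * tanh u < ln (cosh v).
Proof.
move=> uv; have cu := cosh_gt0 u; have cv := cosh_gt0 v.
have -> : cosh v = cosh u * ((1 + tanh u) / 2 * expR (v - u) +
                             (1 - tanh u) / 2 * expR (- (v - u))).
  rewrite /tanh opprB; apply: (@eq_trans _ _
      ((cosh u + sinh u) / 2 * expR (v - u) +
       (cosh u - sinh u) / 2 * expR (u - v))); last first.
    by field; rewrite gt_eqF.
  have -> : cosh u + sinh u = expR u by rewrite /cosh /sinh; field.
  have -> : cosh u - sinh u = expR (- u) by rewrite /cosh /sinh; field.
  by rewrite mulrAC -expRD subrKC mulrAC -expRD addKr /cosh mulrDl.
have J := two_point_jensen (tanh_bound u) (w := v - u).
rewrite lnM ?posrE//; last first.
  by rewrite (lt_trans (expR_gt0 (tanh u * (v - u))))// J// subr_eq0 eq_sym.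
rewrite ltrD2l -ltr_expR lnK ?posrE; last first.
  by rewrite (lt_trans (expR_gt0 (tanh u * (v - u))))// J// subr_eq0 eq_sym.
by rewrite mulrC J// subr_eq0 eq_sym.
Qed.

Lemma ln_cosh_tangent_le u v : ln (cosh u) + (v - u) * tanh u <= ln (cosh v).
Proof.
have [->|uv] := eqVneq u v; first by rewrite subrr mul0r addr0.
exact/ltW/ln_cosh_tangent.
Qed.

(** Sum of the two tangent inequalities at [u] and at [v]. *)
Lemma tanh_mono : {mono (@tanh R) : u v / u <= v}.
Proof.
apply: le_mono => u v uv.
have := @ln_cosh_tangent u v; have := @ln_cosh_tangent v u.
rewrite (gt_eqF uv) (lt_eqF uv) => /(_ isT) A /(_ isT) B.
suff : 0 < (v - u) * (tanh v - tanh u) by rewrite pmulr_rgt0 ?subr_gt0.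
lra.
Qed.

Lemma tanh_ge0 u : 0 <= u -> 0 <= tanh u.
Proof. by rewrite -{2}tanh0 tanh_mono. Qed.

Lemma continuous_cosh : continuous (@cosh R).
Proof.
move=> u; apply: cvgM; last exact: cvg_cst.
apply: cvgD; first exact: continuous_expR.
apply: continuous_comp; [exact: opp_continuous|exact: continuous_expR].
Qed.

Lemma continuous_sinh : continuous (@sinh R).
Proof.
move=> u; apply: cvgM; last exact: cvg_cst.
apply: cvgB; first exact: continuous_expR.
apply: continuous_comp; [exact: opp_continuous|exact: continuous_expR].
Qed.

Lemma continuous_tanh : continuous (@tanh R).
Proof.
move=> u; apply: cvgM; first exact: continuous_sinh.
by apply: cvgV; [rewrite gt_eqF ?cosh_gt0|exact: continuous_cosh].
Qed.

Lemma continuous_ln_cosh : continuous (fun u => ln (cosh u)).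
Proof.
move=> u; apply: continuous_comp; first exact: continuous_cosh.
exact/continuous_ln/cosh_gt0.
Qed.

(** [I0] is the convex conjugate of [ln cosh], here read at the dual point
    [y = tanh u]. *)
Lemma I0_tanh u : I0 (tanh u) = u * tanh u - ln (cosh u).
Proof.
have /andP[_ t1] := tanh_bound u.
by rewrite /I0 lt_eqF// tanhK mulrC.
Qed.

Lemma I0_tanh_lt u v : 0 <= u -> u < v -> I0 (tanh u) < I0 (tanh v).
Proof.
move=> u0 uv; rewrite !I0_tanh.
have := @ln_cosh_tangent v u; rewrite (gt_eqF uv) => /(_ isT) A.
have /ltW B : tanh u < tanh v by rewrite (leW_mono tanh_mono).
have := ler_wpM2l u0 B; lra.
Qed.

Lemma I0_tanh_mono :
  {in Num.nneg &, {mono (fun u => I0 (tanh u)) : u v / u <= v}}.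
Proof.
by apply: le_mono_in => u v; rewrite !nnegrE => u0 _; exact: I0_tanh_lt.
Qed.

Lemma I0_0 : I0 (0 : R) = 0.
Proof. by rewrite -[X in I0 X]tanh0 I0_tanh mul0r cosh0 ln1 subrr. Qed.

Lemma I0_tanh_ge0 u : 0 <= u -> 0 <= I0 (tanh u).
Proof.
by move=> u0; rewrite -{1}I0_0 -[X in I0 X]tanh0 I0_tanh_mono// nnegrE.
Qed.

Lemma I0_tanh_lt_ln2 u : 0 <= u -> I0 (tanh u) < ln 2.
Proof.
move=> u0; rewrite I0_tanh.
have /andP[_ /ltW t1] := tanh_bound u.
have : u - ln 2 < ln (cosh u).
  rewrite -ltr_expR lnK ?posrE ?cosh_gt0// expRB lnK ?posrE// /cosh.
  by rewrite ltr_pM2r// ltrDl expR_gt0.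
have := ler_wpM2l u0 t1; lra.
Qed.

(** A quantitative form of [I0 (tanh u) --> ln 2] at infinity. With
    [q = exp (- 2 u)], [I0 (tanh u) >= ln 2 - (2 u + 1) q], and
    [q <= (1 + u)^-2]. *)
Lemma I0_tanh_lb u : 0 <= u -> ln 2 - 2 / (1 + u) <= I0 (tanh u).
Proof.
move=> u0; have u1 : 0 < 1 + u by lra.
have E1 := expR_gt0 u; have E2 := expR_gt0 (- u).
pose q := expR (- u) / expR u.
have q0 : 0 < q by rewrite divr_gt0.
have qE : q * (1 + u) ^+ 2 <= 1.
  have -> : q = (expR u ^+ 2)^-1 by rewrite /q expRN; field; rewrite gt_eqF.
  rewrite mulrC ler_pdivrMr ?exprn_gt0// mul1r.
  by rewrite ler_sqr ?nnegrE ?expR_ge0 ?expR_ge1Dx// ltW.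
have cE : ln (cosh u) = u + ln (1 + q) - ln 2.
  have -> : cosh u = expR u * (1 + q) / 2.
    by rewrite /cosh /q; field; rewrite gt_eqF.
  rewrite ln_div ?posrE ?mulr_gt0//; last by lra.
  by rewrite lnM ?posrE ?expRK//; lra.
have tE : tanh u = (1 - q) / (1 + q).
  by rewrite /tanh /sinh /cosh /q; field; rewrite !gt_eqF ?addr_gt0.
have lq : ln (1 + q) <= q by rewrite le_ln1Dx//; lra.
have tq : 1 - 2 * q <= tanh u.
  rewrite tE ler_pdivlMr; last by lra.
  by have := sqr_ge0 q; rewrite expr2; lra.
rewrite I0_tanh cE.
have := ler_wpM2l u0 tq.
have : q * (2 * u + 1) <= 2 / (1 + u).
  rewrite ler_pdivlMr// .
  have : 0 <= q * (1 + u) by rewrite mulr_ge0// ltW.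
  have : 0 <= q * u ^+ 2 by rewrite mulr_ge0 ?sqr_ge0// ltW.
  move: qE; rewrite !expr2; lra.
lra.
Qed.

Lemma continuous_I0_tanh : continuous (fun u => I0 (tanh u)).
Proof.
have -> : (fun u => I0 (tanh u)) = (fun u => u * tanh u - ln (cosh u)).
  by apply/funext => u; rewrite I0_tanh.
move=> u; apply: cvgB; last exact: continuous_ln_cosh.
by apply: cvgM; [exact: cvg_id|exact: continuous_tanh].
Qed.

Lemma tanh_artanh_ge0 y : 0 <= y < 1 -> 0 <= artanh y /\ tanh (artanh y) = y.
Proof.
move=> /andP[y0 y1]; have E : tanh (artanh y) = y.
  by apply: artanhK; apply/andP; split => //; lra.
by split => //; rewrite -tanh_mono E tanh0.
Qed.

End log_cosh.

(** * The annealed free energy and its critical point *)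

Section free_energy_profile.
Context {R : realType}.
Variables a h : R.
Hypotheses (a0 : 0 < a) (h0 : 0 < h).
Implicit Types b c y : R.

(** The value of [N^-1 ln (E Z_N)], the same for all [N >= 1]. *)
Definition annealed b : R := ln 2 + b ^+ 2 * a ^+ 2 / 2 + ln (cosh (b * h)).

(** The derivative of [annealed], that is the value of [- H_N / N] that
    dominates in [E Z_N]. *)
Definition mean_energy b : R := a ^+ 2 * b + h * tanh (b * h).

(** The large deviation cost per spin of the pair (energy, magnetization)
    that dominates in [E Z_N]; configurations realizing it exist as long as it
    is below [ln 2]. *)
Definition entropy_cost b : R := b ^+ 2 * a ^+ 2 / 2 + I0 (tanh (b * h)).

Definition critical b : Prop := 0 < b /\ entropy_cost b = ln 2.

Lemma annealed_tangent b c : b != c ->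
  annealed b + (c - b) * mean_energy b < annealed c.
Proof.
move=> bc; rewrite /annealed /mean_energy.
have := ln_cosh_tangent_le (b * h) (c * h).
have : 0 < a ^+ 2 * (c - b) ^+ 2.
  rewrite mulr_gt0//; first exact: exprn_gt0.
  by rewrite exprn_even_gt0//= subr_eq0 eq_sym.
lra.
Qed.

(** Legendre duality for [annealed]: the tangent at [b] meets the vertical
    axis at [ln 2 - entropy_cost b]. *)
Lemma entropy_costE b :
  b * mean_energy b = annealed b + (entropy_cost b - ln 2).
Proof. by rewrite /entropy_cost I0_tanh /mean_energy /annealed; field. Qed.

Lemma entropy_cost_lt b c : 0 <= b -> b < c ->
  entropy_cost b < entropy_cost c.
Proof.
move=> b_ge0 bc; rewrite /entropy_cost ler_ltD//.
- rewrite ler_pM2r// ler_pM2r ?exprn_gt0// ler_sqr ?nnegrE// ltW//.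
  exact: le_lt_trans bc.
- by apply: I0_tanh_lt; [rewrite mulr_ge0// ltW|rewrite ltr_pM2r].
Qed.

Lemma critical_unique b c : critical b -> critical c -> b = c.
Proof.
move=> [b1 bE] [c1 cE]; case: (ltgtP b c) => // [|] lt.
- by have := entropy_cost_lt (ltW b1) lt; rewrite bE cE ltxx.
- by have := entropy_cost_lt (ltW c1) lt; rewrite bE cE ltxx.
Qed.

(** Intermediate value theorem on [[0, U]]; the Gaussian part of the cost
    already equals [ln 2] at [U]. *)
Lemma critical_exists : exists b, critical b.
Proof.
pose U := Num.sqrt (2 * ln 2) / a.
have l2 : 0 < ln 2 :> R by rewrite ln_gt0// ltr1n.
have U0 : 0 < U by rewrite divr_gt0// sqrtr_gt0 mulr_gt0.
have cont : {within `[0, U], continuous entropy_cost}.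
  apply: continuous_subspaceT => x; apply: cvgD.
    apply: cvgM; last exact: cvg_cst.
    by apply: cvgM; [exact: exprn_continuous|exact: cvg_cst].
  apply: (@continuous_comp _ _ _ (fun b => b * h) (fun u => I0 (tanh u))).
    by apply: cvgM; [exact: cvg_id|exact: cvg_cst].
  exact: continuous_I0_tanh.
have E0 : entropy_cost 0 = 0.
  by rewrite /entropy_cost mul0r tanh0 I0_0 expr0n/= !mul0r addr0.
have EU : ln 2 <= entropy_cost U.
  rewrite /entropy_cost /U expr_div_n sqr_sqrtr; last by rewrite ltW ?mulr_gt0.
  rewrite mulfVK ?gt_eqF ?exprn_gt0// mulrAC divff// mul1r lerDl.
  by rewrite I0_tanh_ge0// mulr_ge0// ltW.
have [|b bU bE] := IVT (ltW U0) cont (v := ln 2).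
  by rewrite E0 ge_min (ltW l2) /= le_max EU orbT.
exists b; split=> //; rewrite lt_neqAle.
move: bU; rewrite in_itv/= => /andP[-> _]; rewrite andbT.
by apply: contraTneq l2 => b0; rewrite -bE -b0 E0 ltxx.
Qed.

(** The substitution [y = tanh (b h)] turns the equation for [y0] into
    criticality of [b]. *)
Lemma critical_is_y0 b : critical b -> is_y0 a h (tanh (b * h)).
Proof.
move=> [b0 bE]; have /andP[_ t1] := tanh_bound (b * h).
split; first by rewrite t1 tanh_ge0// mulr_ge0// ltW.
rewrite tanhK -bE /entropy_cost addrK.
rewrite (_ : 2 * (b ^+ 2 * a ^+ 2 / 2) = (a * b) ^+ 2); last by field.
rewrite sqrtr_sqr gtr0_norm ?mulr_gt0//.
by field; rewrite !gt_eqF.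
Qed.

Lemma is_y0_critical y : is_y0 a h y ->
  critical (artanh y / h) /\ y = tanh (artanh y / h * h).
Proof.
move=> [y01 yE]; have [u0 uE] := tanh_artanh_ge0 y01.
rewrite mulfVK ?gt_eqF// uE; split=> //.
set u := artanh y in u0 uE yE *.
pose D := 2 * (ln 2 - I0 y); have D0 : 0 < D.
  by rewrite mulr_gt0// subr_gt0 -uE I0_tanh_lt_ln2.
have un0 : u != 0.
  by apply: contraTneq h0 => E; rewrite -yE E mulr0 mul0r ltxx.
split; first by rewrite divr_gt0// lt_neqAle eq_sym un0.
rewrite /entropy_cost mulfVK ?gt_eqF// uE.
have sD : Num.sqrt D != 0 by rewrite gt_eqF// sqrtr_gt0.
have E : (u / h) ^+ 2 * a ^+ 2 = D.
  rewrite -[RHS]sqr_sqrtr ?ltW// -exprMn -yE -/D; congr (_ ^+ 2).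
  by field; rewrite ?sD ?un0 ?gt_eqF.
by rewrite E /D; field.
Qed.

Lemma is_y0_exists_unique : exists! y, is_y0 a h y.
Proof.
have [b bP] := critical_exists.
exists (tanh (b * h)); split; first exact: critical_is_y0.
by move=> y /is_y0_critical[yP ->]; rewrite (critical_unique bP yP).
Qed.

Lemma is_cbeta_exists_unique b : 0 < b -> b <= beta_threshold a ->
  exists! c, is_cbeta a b c.
Proof.
move=> b0 bt; set target := ln 2 - b ^+ 2 * a ^+ 2 / 2.
have l2 : 0 < ln 2 :> R by rewrite ln_gt0// ltr1n.
have ab0 : 0 < a * b by rewrite mulr_gt0.
have t_lt : target < ln 2.
  by rewrite ltrBlDr ltrDl divr_gt0// mulr_gt0// exprn_gt0.
have t_ge : 0 <= target.
  have : (a * b) ^+ 2 <= 2 * ln 2.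
    have l22 : 0 <= 2 * ln 2 :> R by rewrite mulr_ge0// ltW.
    rewrite -[leRHS]sqr_sqrtr// ler_sqr ?nnegrE ?sqrtr_ge0 ?(ltW ab0)//.
    by move: bt; rewrite /beta_threshold ler_pdivlMl.
  rewrite exprMn /target; lra.
pose e := ln 2 - target; have e0 : 0 < e by rewrite subr_gt0.
(* chosen for the lower bound I0_tanh_lb to reach the target at U *)
pose U := 2 / e; have U0 : 0 <= U by rewrite divr_ge0// ltW.
have cont : {within `[0, U], continuous (fun u : R => I0 (tanh u))}.
  by apply: continuous_subspaceT => x; exact: continuous_I0_tanh.
have EU : target <= I0 (tanh U).
  apply: le_trans (I0_tanh_lb U0).
  have U1 : 0 < 1 + U by lra.
  have : 2 / (1 + U) <= e.
    by rewrite ler_pdivrMr// mulrDr mulr1 /U mulrCA divff ?gt_eqF// mulr1; lra.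
  rewrite /e; lra.
have [|u uU uE] := IVT U0 cont (v := target).
  by rewrite tanh0 I0_0 ge_min t_ge /= le_max EU orbT.
have u0 : 0 <= u by move: uU; rewrite in_itv/= => /andP[].
have /andP[_ t1] := tanh_bound u.
exists (tanh u); split.
  by split=> //; rewrite (ltW t1) tanh_ge0.
move=> c [/andP[c0 c1] cE].
have cn1 : c != 1.
  by apply: contraTneq t_lt => E; rewrite /target -cE E /I0 eqxx ltxx.
have [v0 vE] : 0 <= artanh c /\ tanh (artanh c) = c.
  by apply: tanh_artanh_ge0; rewrite c0 lt_neqAle cn1.
have : I0 (tanh u) = I0 (tanh (artanh c)) by rewrite vE cE.
move=> E; rewrite -vE; move: E; case: (ltgtP u (artanh c)) => [uv|vu|-> //] E.
- by have := I0_tanh_lt u0 uv; rewrite E ltxx.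
- by have := I0_tanh_lt v0 vu; rewrite E ltxx.
Qed.

(** The map [b |-> annealed b / b] strictly decreases up to any [c] where the
    tangent to [annealed] meets the vertical axis above [0]. *)
Lemma annealed_ratio_decreasing b c : 0 < b -> b < c ->
  c * mean_energy c <= annealed c -> c * annealed b > b * annealed c.
Proof.
move=> b0 bc cm.
have c0 := lt_trans b0 bc.
have := @annealed_tangent c b; rewrite (gt_eqF bc) => /(_ isT).
rewrite -(ltr_pM2l c0).
have := ler_wpM2l (ltW (_ : 0 < c - b)) cm; rewrite subr_gt0 => /(_ bc).
lra.
Qed.

(** At a critical point the tangent to [annealed] passes through the origin,
    hence the linear continuation [beta * mean_energy b] of the free energy
    past [b] is a tangent line. *)
Lemma critical_mean_energy b : critical b -> b * mean_energy b = annealed b.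
Proof.
by move=> [b0 bE]; rewrite entropy_costE bE subrr addr0.
Qed.

Lemma high_temperature b c : critical b -> 0 <= c -> c <= b ->
  c * mean_energy c <= annealed c.
Proof.
move=> bP c0; rewrite entropy_costE gerDl subr_le0 le_eqVlt.
case/predU1P => [->|cb]; first by rewrite (proj2 bP).
by rewrite -(proj2 bP) ltW// entropy_cost_lt.
Qed.

(** Both conditions on [beta] defining the first branch say that [beta] is
    below the critical point [b], where [y0 = tanh (b h)]: since [I0 c] is
    [ln 2 - beta^2 a^2 / 2] and [I0 y0] is [ln 2 - b^2 a^2 / 2], [y0 <= c] is
    [beta <= b]; and [b] never exceeds the threshold, as [I0 y0 >= 0]. *)
Lemma limiting_free_energyE beta y c : 0 < beta -> is_y0 a h y ->
    (beta <= beta_threshold a -> is_cbeta a beta c) ->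
  exists2 b, critical b &
    limiting_free_energy a h beta y c =
      if beta <= b then annealed beta else beta * mean_energy b.
Proof.
move=> beta0 yP cP; have [bP yE] := is_y0_critical yP.
set b := artanh y / h in bP yE; exists b => //.
have [b0 bE] := bP; rewrite /entropy_cost in bE.
have bh0 : 0 <= b * h by rewrite mulr_ge0// ltW.
rewrite /limiting_free_energy.
have -> : a * (a * artanh y / h) + h * y = mean_energy b.
  by rewrite /mean_energy {2}yE /b; field; rewrite gt_eqF.
suff -> : (beta <= beta_threshold a) && (y <= c) = (beta <= b) by [].
have [bt/=|bt/=] := leP beta (beta_threshold a); last first.
  apply/esym/negbTE; rewrite -ltNge; apply: le_lt_trans bt.
  rewrite /beta_threshold ler_pdivlMl//.
  have ab0 : 0 <= a * b by rewrite mulr_ge0// ltW.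
  rewrite -ler_sqr ?nnegrE ?sqrtr_ge0//.
  rewrite sqr_sqrtr; last by rewrite mulr_ge0 ?ln_ge0 ?ler1n.
  rewrite exprMn; have := I0_tanh_ge0 bh0; lra.
have [/andP[c0 c1] cE] := cP bt.
have cn1 : c < 1.
  rewrite lt_neqAle c1 andbT; apply/eqP => c1E.
  have : 0 < beta ^+ 2 * a ^+ 2 by rewrite mulr_gt0// exprn_gt0.
  by move: cE; rewrite c1E /I0 eqxx; lra.
have [u0 uE] : 0 <= artanh c /\ tanh (artanh c) = c.
  by apply: tanh_artanh_ge0; rewrite c0.
rewrite yE -uE tanh_mono -I0_tanh_mono ?nnegrE// uE cE -bE.
transitivity (beta ^+ 2 * a ^+ 2 / 2 <= b ^+ 2 * a ^+ 2 / 2).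
  by apply/idP/idP; lra.
by rewrite ler_pM2r// ler_pM2r ?exprn_gt0// ler_sqr ?nnegrE// ltW.
Qed.

Lemma continuous_mean_energy : continuous mean_energy.
Proof.
move=> b; apply: cvgD; first by apply: cvgM; [exact: cvg_cst|exact: cvg_id].
apply: cvgM; first exact: cvg_cst.
apply: (@continuous_comp _ _ _ (fun b => b * h) tanh).
  by apply: cvgM; [exact: cvg_id|exact: cvg_cst].
exact: continuous_tanh.
Qed.

Lemma continuous_annealed : continuous annealed.
Proof.
move=> b; apply: cvgD.
  apply: cvgD; first exact: cvg_cst.
  apply: cvgM; last exact: cvg_cst.
  by apply: cvgM; [exact: exprn_continuous|exact: cvg_cst].
apply: (@continuous_comp _ _ _ (fun b => b * h) (fun u => ln (cosh u))).
  by apply: cvgM; [exact: cvg_id|exact: cvg_cst].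
exact: continuous_ln_cosh.
Qed.

End free_energy_profile.

(** * Convexity of log-partition functions *)

Section gibbs_sum.
Context {R : realType} {I : finType}.
Variables (x : I -> R) (i0 : I).
Implicit Types b c s t : R.

Definition gibbs_sum s : R := \sum_i expR (s * x i).

Lemma gibbs_sum_gt0 s : 0 < gibbs_sum s.
Proof.
rewrite /gibbs_sum (bigD1 i0)//= ltr_pwDl ?expR_gt0//.
by apply: sumr_ge0 => i _; exact: expR_ge0.
Qed.

(** The log-partition function is convex with derivative the Gibbs mean of
    [x]: apply Jensen's inequality under the Gibbs measure at [s]. *)
Lemma ln_gibbs_sum_tangent s t :
  ln (gibbs_sum s) + (t - s) * (\sum_i x i * expR (s * x i) / gibbs_sum s)
    <= ln (gibbs_sum t).
Proof.
have Zs := gibbs_sum_gt0 s; have Zt := gibbs_sum_gt0 t.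
set m := \sum_i _.
rewrite -ler_expR expRD !lnK ?posrE//.
have E i : expR (s * x i) * (1 + ((t - s) * x i - (t - s) * m)) <=
           expR (t * x i) / expR ((t - s) * m).
  rewrite -expRB (_ : t * x i - (t - s) * m =
    s * x i + ((t - s) * x i - (t - s) * m)); last by ring.
  by rewrite expRD ler_pM2l ?expR_gt0// expR_ge1Dx.
rewrite -ler_pdivlMr ?expR_gt0//.
apply: le_trans (_ : \sum_i _ <= _); last first.
  by rewrite mulr_suml; apply: ler_sum => i _; exact: E.
have mE : \sum_i x i * expR (s * x i) = m * gibbs_sum s.
  by rewrite /m -mulr_suml mulfVK ?gt_eqF.
rewrite (eq_bigr (fun i => (1 - (t - s) * m) * expR (s * x i) +
    (t - s) * (x i * expR (s * x i)))); last by move=> i _; ring.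
rewrite big_split/= -!mulr_sumr mE -/(gibbs_sum s).
by rewrite le_eqVlt; apply/orP; left; apply/eqP; ring.
Qed.

Lemma ln_gibbs_sum_convex b1 b2 c : b1 < b2 -> b2 <= c ->
  (c - b2) * (ln (gibbs_sum b2) - ln (gibbs_sum b1)) <=
  (b2 - b1) * (ln (gibbs_sum c) - ln (gibbs_sum b2)).
Proof.
rewrite -subr_gt0 -(subr_ge0 b2) => b12 b2c.
have := ler_wpM2l b2c (ln_gibbs_sum_tangent b2 b1).
have := ler_wpM2l (ltW b12) (ln_gibbs_sum_tangent b2 c).
lra.
Qed.

(** [ln Z(b) / b] is nonincreasing: no [x i] exceeds [M = ln Z(b) / b], so the
    extra factor [exp ((c - b) x i)] is at most [exp ((c - b) M)]. *)
Lemma ln_gibbs_sum_scale b c : 0 < b -> b <= c ->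
  b * ln (gibbs_sum c) <= c * ln (gibbs_sum b).
Proof.
move=> b0 bc; have Zb := gibbs_sum_gt0 b; have Zc := gibbs_sum_gt0 c.
pose M := ln (gibbs_sum b) / b.
have xM i : x i <= M.
  rewrite ler_pdivlMr// mulrC -ler_expR lnK ?posrE//.
  rewrite /gibbs_sum (bigD1 i)//= lerDl.
  by apply: sumr_ge0 => j _; exact: expR_ge0.
have : gibbs_sum c <= gibbs_sum b * expR ((c - b) * M).
  rewrite mulr_suml; apply: ler_sum => i _.
  rewrite -expRD ler_expR.
  have := ler_wpM2l (_ : 0 <= c - b) (xM i); rewrite subr_ge0 => /(_ bc); lra.
rewrite -ler_ln ?posrE ?mulr_gt0 ?expR_gt0// lnM ?posrE ?expR_gt0// expRK.
rewrite -(ler_pM2l b0) => /le_trans; apply.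
rewrite le_eqVlt; apply/orP; left; apply/eqP; rewrite /M; field.
by rewrite gt_eqF.
Qed.

End gibbs_sum.

(** With [x = exp y] this is [exp (- x) <= 1 - x + x ^ p] for [x >= 0]. For
    [x <= 1] it follows from [exp (- x) <= 1 / (1 + x) <= 1 - x + x ^ 2] and
    [x ^ 2 <= x ^ p]; for [x >= 1] from [x <= x ^ p]. *)
Lemma expRN_le_power {R : realType} (p y : R) : 1 <= p <= 2 ->
  expR (- expR y) + expR y <= 1 + expR (p * y).
Proof.
move=> /andP[p1 p2].
have e0 := expR_gt0 y.
have [y0|y0] := leP y 0.
  have A : expR y ^+ 2 <= expR (p * y).
    rewrite -expRM_natl ler_expR.
    have := ler_wpM2r (_ : 0 <= - y) p2; rewrite oppr_ge0 => /(_ y0); lra.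
  suff : expR (- expR y) <= 1 - expR y + expR y ^+ 2 by lra.
  rewrite expRN; apply: (@le_trans _ _ (1 + expR y)^-1).
    by rewrite lef_pV2 ?posrE ?expR_gt0 ?expR_ge1Dx// addr_gt0.
  rewrite -div1r ler_pdivrMr ?addr_gt0//.
  have : 0 <= expR y ^+ 3 by rewrite exprn_ge0// ltW.
  rewrite !exprS expr0; lra.
have A : expR (- expR y) <= 1 by rewrite expR_le1 oppr_le0 ltW.
have : expR y <= expR (p * y).
  by rewrite ler_expR; have := ler_wpM2r (ltW y0) p1; rewrite mul1r.
lra.
Qed.

(** * Expectations of products of independent variables *)

Section transport.
Local Open Scope ereal_scope.
Context d1 d2 (X : measurableType d1) (Y : measurableType d2) (R : realType).
Variables (mu : {measure set X -> \bar R}) (nu : {measure set Y -> \bar R}).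
Variables (phi : X -> Y) (W : X -> R).
Hypotheses (mphi : measurable_fun setT phi) (mW : measurable_fun setT W).
Hypothesis W0 : forall x, (0 <= W x)%R.
Hypothesis nuE : forall B, measurable B ->
  nu B = \int[mu]_x (W x * \1_B (phi x))%:E.

Import HBNNSimple.

Let mindic (B : set Y) : measurable B ->
  measurable_fun setT (fun x => (\1_B (phi x) : R)).
Proof. by move=> mB; apply: measurableT_comp. Qed.

Lemma nnsfun_integral_transport (f : {nnsfun Y >-> R}) :
  \int[nu]_y (f y)%:E = \int[mu]_x (W x * f (phi x))%:E.
Proof.
have mf r : measurable (f @^-1` [set r]) by exact: measurable_sfunP.
transitivity (\int[mu]_x (\sum_(r \in range f)
    (W x * (r * \1_(f @^-1` [set r]) (phi x)))%:E)); last first.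
  apply: eq_integral => x _.
  by rewrite fsumEFin// -mulr_fsumr [in RHS](fimfunE f).
rewrite ge0_integral_fsum//; last 2 first.
- move=> r; apply/measurable_EFinP; apply: measurable_funM => //.
  by apply: measurable_funM => //; exact: mindic.
- move=> r x _; rewrite EFinM mule_ge0 ?lee_fin//.
  by have := nnfun_muleindic_ge0 f r (phi x); rewrite lee_fin.
rewrite integralT_nnsfun sintegralE; apply: eq_fsbigr => r /[!inE] -[y _ yr].
have r0 : (0 <= r)%R by rewrite -yr.
rewrite nuE// -ge0_integralZl//; last 2 first.
- apply/measurable_EFinP; apply: measurable_funM => //; exact: mindic.
- by move=> x _; rewrite lee_fin mulr_ge0.
by apply: eq_integral => x _; rewrite -EFinM mulrCA.
Qed.

(** If [nu] is the image under [phi] of the measure of density [W] with respect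
    to [mu], then integrals against [nu] can be computed against [mu]. Monotone
    approximation reduces it to the case of indicators. It serves both for
    densities ([phi] the identity) and for independence, where [W] is a
    function of the other variables. *)
Lemma ge0_integral_transport (g : Y -> R) :
  measurable_fun setT g -> (forall y, (0 <= g y)%R) ->
  \int[nu]_y (g y)%:E = \int[mu]_x (W x * g (phi x))%:E.
Proof.
move=> mg g0; have mG : measurable_fun setT (EFin \o g) by exact/measurable_EFinP.
pose f := nnsfun_approx measurableT mG.
have fg y : EFin \o f^~ y @ \oo --> (g y)%:E.
  by apply: cvg_nnsfun_approx => // z _ /=; rewrite lee_fin.
transitivity (limn (fun n => \int[nu]_y (f n y)%:E)).
  rewrite -monotone_convergence//.
  - by apply: eq_integral => y _; apply/esym/cvg_lim => //; exact: fg.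
  - by move=> n; exact/measurable_EFinP.
  - by move=> n y _; rewrite lee_fin.
  - by move=> y _ m n mn; rewrite lee_fin; exact/lefP/nd_nnsfun_approx.
transitivity (limn (fun n => \int[mu]_x (W x * f n (phi x))%:E)).
  by congr (lim (_ @ \oo)); apply/funext => n; exact: nnsfun_integral_transport.
rewrite -monotone_convergence//.
- apply: eq_integral => x _; apply/cvg_lim => //.
  have WE : (W x)%:E \is a fin_num by [].
  exact: (cvgeZl WE (fg (phi x))).
- move=> n /=; apply/measurable_EFinP; apply: measurable_funM => //.
  exact: measurableT_comp.
- by move=> n x _; rewrite lee_fin mulr_ge0.
- move=> x _ m n mn; rewrite lee_fin ler_wpM2l//.
  exact/lefP/nd_nnsfun_approx.
Qed.

End transport.

Section independence.
Local Open Scope ereal_scope.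
Context d (T : measurableType d) (R : realType) (P : probability T R).
Context (I : finType) (X : I -> {RV P >-> R}).
Hypothesis indX : mutually_independent X.

Lemma expectation_prod_indic (B : I -> set R) : (forall i, measurable (B i)) ->
  \int[P]_w (\prod_i (\1_(B i) (X i w) : R))%:E =
  \prod_i \int[P]_w (\1_(B i) (X i w) : R)%:E.
Proof.
move=> mB; have mXB i : measurable (X i @^-1` B i).
  by rewrite -[X in measurable X]setTI; exact: measurable_funP.
have -> : \prod_i \int[P]_w (\1_(B i) (X i w) : R)%:E =
    \prod_(i in [set: I]%SET) P (X i @^-1` B i).
  apply: eq_big => [i|i _]; first by rewrite inE.
  by rewrite -(setIT (X i @^-1` B i)) -integral_indic.
rewrite -indX//; set C := \bigcap_(i in _) _.
rewrite -[in RHS](setIT C) -integral_indic//; last first.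
  by apply: fin_bigcap_measurable => // i _; exact: mXB.
apply: eq_integral => w _; congr (_%:E).
rewrite indicE; case: (asboolP (C w)) => [Bw|nBw].
- rewrite mem_set// big1// => i _; rewrite indicE mem_set//.
  by apply: Bw; rewrite /= inE.
- rewrite memNset//; have /existsNP[i /not_implyP[_ Bi]] := nBw.
  by rewrite (bigD1 i)//= indicE memNset// mul0r.
Qed.

(** Coordinates are upgraded one at a time from indicators to bounded
    functions: with all factors but the [i]th frozen into [W], the identity
    for every indicator of [X i] says that a multiple of the law of [X i] is
    the image of the measure of density [W], and
    [ge0_integral_transport] extends it to [g i]. *)
Lemma expectation_prod (g : I -> R -> R) :
    (forall i, measurable_fun setT (g i)) ->
    (forall i x, 0 <= g i x <= 1)%R ->
  \int[P]_w (\prod_i g i (X i w))%:E = \prod_i \int[P]_w (g i (X i w))%:E.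
Proof.
(* s lists the coordinates at which g need not be an indicator *)
suff : forall (s : seq I) (g : I -> R -> R),
    (forall i, measurable_fun setT (g i)) ->
    (forall i x, 0 <= g i x <= 1)%R ->
    (forall i, i \notin s -> exists2 B, measurable B & g i = \1_B) ->
    \int[P]_w (\prod_i g i (X i w))%:E = \prod_i \int[P]_w (g i (X i w))%:E.
  by move=> H mg g01; apply: (H (enum I)) => // i; rewrite mem_enum.
elim=> [|i s IH] {}g mg g01 gB.
  have /choice[B BP] : forall i, exists B, measurable B /\ g i = \1_B.
    by move=> i; have [//|B mB E] := gB i; exists B.
  have -> : g = (fun i => \1_(B i)) by apply/funext => i; case: (BP i).
  by apply: expectation_prod_indic => i; case: (BP i).
have g0 j x : (0 <= g j x)%R by case/andP: (g01 j x).
have mgX j : measurable_fun setT (fun w => g j (X j w)).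
  exact: measurableT_comp.
have E0 j : 0 <= \int[P]_w (g j (X j w))%:E.
  by apply: integral_ge0 => w _; rewrite lee_fin.
have fin j : \int[P]_w (g j (X j w))%:E \is a fin_num.
  rewrite ge0_fin_numE//; apply: (@le_lt_trans _ _ (\int[P]_w (cst 1 w))).
    apply: ge0_le_integral => //.
    - by move=> w _; rewrite lee_fin.
    - exact/measurable_EFinP.
    - by move=> w _; rewrite lee_fin; case/andP: (g01 j (X j w)).
  rewrite integral_cst// mul1e.
  by apply: le_lt_trans (ltry 1%R); exact: probability_le1.
pose W w := (\prod_(j | j != i) g j (X j w))%R.
pose c := \prod_(j | j != i) \int[P]_w (g j (X j w))%:E.
have c0 : (0 <= fine c)%R by rewrite fine_ge0// prode_ge0.
have cE : (fine c)%:E = c by rewrite fineK// prode_fin_num.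
have WE w : (\prod_j g j (X j w) = W w * g i (X i w))%R.
  by rewrite (bigD1 i)//= mulrC.
rewrite [RHS](bigD1 i)//= -/c muleC -cE.
pose nu := mscale (NngNum c0) (distribution P (X i)).
have <- : \int[nu]_y (g i y)%:E = (fine c)%:E * \int[P]_w (g i (X i w))%:E.
  rewrite ge0_integral_mscale//=; last 2 first.
  - exact/measurable_EFinP.
  - by move=> y _; rewrite lee_fin.
  rewrite ge0_integral_distribution//; first exact/measurable_EFinP.
  by move=> y; rewrite lee_fin.
rewrite (ge0_integral_transport (mu := P) (phi := X i) (W := W))//.
- by apply: eq_integral => w _; rewrite WE.
- rewrite /W; under eq_fun do rewrite -big_filter.
  by apply: measurable_prod => j _; exact: mgX.
- by move=> w; apply: prodr_ge0.
move=> B mB.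
pose g' j := if j == i then \1_B else g j.
have g'i : g' i = \1_B by rewrite /g' eqxx.
have g'j j : j != i -> g' j = g j by rewrite /g' => /negbTE ->.
have H : \int[P]_w (\prod_j g' j (X j w))%:E = \prod_j \int[P]_w (g' j (X j w))%:E.
  apply: IH => [j|j x|j js].
  - by have [->|/g'j ->//] := eqVneq j i; rewrite g'i.
  - have [->|/g'j ->//] := eqVneq j i.
    by rewrite g'i indicE ler0n lern1 leq_b1.
  - have [->|ji] := eqVneq j i; first by exists B.
    by rewrite g'j//; apply: gB; rewrite inE negb_or ji.
transitivity ((fine c)%:E * P (X i @^-1` B)); first by [].
have mXB : measurable (X i @^-1` B).
  by rewrite -[Y in measurable Y]setTI; exact: measurable_funP.
have <- : \int[P]_w (g' i (X i w))%:E = P (X i @^-1` B).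
  by rewrite g'i -[in RHS](setIT (X i @^-1` B)) -integral_indic.
have -> : (fine c)%:E = \prod_(j | j != i) \int[P]_w (g' j (X j w))%:E.
  by rewrite cE; apply: eq_bigr => j /g'j ->.
move: H; rewrite [X in _ = X -> _](bigD1 i)//= muleC => <-.
apply: eq_integral => w _; rewrite (bigD1 i)//= g'i mulrC; congr (_ * _)%:E.
by apply: eq_bigr => j /g'j ->.
Qed.

End independence.

(** * Gaussian moments and Borel-Cantelli *)

Section probability_tools.
Local Open Scope ereal_scope.
Context d (T : measurableType d) (R : realType) (P : probability T R).

(** Completing the square: [exp (t x)] times the density of mean [0] is
    [exp (t^2 s^2 / 2)] times the density of mean [t s^2]. *)
Lemma normal_mgf (X : {RV P >-> R}) (s t : R) : s != 0%R ->
    (forall B, measurable B -> distribution P X B = normal_prob 0 s B) ->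
  \int[P]_w (expR (t * X w))%:E = (expR (t ^+ 2 * s ^+ 2 / 2))%:E.
Proof.
move=> s0 XE.
have mexp : measurable_fun setT (fun x : R => expR (t * x)).
  by apply: measurableT_comp => //; exact: measurable_funM.
transitivity (\int[distribution P X]_x (expR (t * x))%:E).
  by rewrite ge0_integral_distribution//; exact/measurable_EFinP.
transitivity (\int[lebesgue_measure]_x (normal_pdf 0 s x * expR (t * x))%:E).
  apply: (@ge0_integral_transport _ _ _ _ R lebesgue_measure (distribution P X)
    idfun (normal_pdf 0 s)) => //.
  - exact: measurable_id.
  - exact: measurable_normal_pdf.
  - by move=> x; exact: normal_pdf_ge0.
  - move=> B mB; apply: (etrans (XE B mB)).
    rewrite /normal_prob [LHS]integral_mkcond.
    apply: eq_integral => x _; rewrite patchE indicE.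
    by case: ifPn => xB; rewrite ?mulr1 ?mulr0.
rewrite -[RHS]mule1 -(integral_normal_pdf (t * s ^+ 2) s) -ge0_integralZl//.
- apply: eq_integral => x _; rewrite -EFinM; congr (_%:E).
  rewrite !normal_pdfE//= -[LHS]mulrA [RHS]mulrCA; congr (_ * _)%R.
  by rewrite /normal_fun -!expRD; congr expR; field; rewrite s0.
- by apply/measurable_EFinP; exact: measurable_normal_pdf.
- by move=> x _; rewrite lee_fin normal_pdf_ge0.
Qed.

Lemma markov_bound (Y : T -> R) (m t : R) : measurable_fun setT Y ->
    (forall w, (0 <= Y w)%R) -> (0 < t)%R -> \int[P]_w (Y w)%:E <= m%:E ->
  P [set w | (t <= Y w)%R] <= (m / t)%:E.
Proof.
move=> mY Y0 t0 Ym.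
have mE : measurable_fun setT (EFin \o Y) by exact/measurable_EFinP.
have := le_integral_abse P measurableT mE t0; rewrite setTI.
have -> : [set x | t%:E <= `|(EFin \o Y) x|] = [set w | (t <= Y w)%R].
  by apply/seteqP; split => w /=; rewrite lee_fin ger0_norm.
have -> : \int[P]_x `|(EFin \o Y) x| = \int[P]_w (Y w)%:E.
  by apply: eq_integral => w _; rewrite /= ger0_norm.
by move=> /le_trans/(_ Ym); rewrite EFinM lee_pdivlMr// muleC.
Qed.

Lemma borel_cantelli_geometric (A : nat -> set T) (c r : R) :
    (0 <= r < 1)%R -> (forall n, measurable (A n)) ->
    (forall n, P (A n) <= (c * r ^+ n)%:E) ->
  {ae P, forall w, \forall n \near \oo, ~ A n w}.
Proof.
move=> /andP[r0 r1] mA PA.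
have c0 : (0 <= c)%R.
  by have := le_trans (measure_ge0 P (A 0%N)) (PA 0%N); rewrite expr0 mulr1 lee_fin.
have sum_lty : \sum_(n <oo) P (A n) < +oo.
  apply: (@le_lt_trans _ _ (\sum_(n <oo) (c * r ^+ n)%:E)).
    exact: lee_nneseries.
  apply: (@le_lt_trans _ _ (c / (1 - r))%:E); last exact: ltry.
  apply: lime_le.
    by apply: is_cvg_nneseries => n _ _; rewrite lee_fin mulr_ge0// exprn_ge0.
  apply: nearW => n; rewrite sumEFin lee_fin.
  have r1' : (0 < 1 - r)%R by rewrite subr_gt0.
  rewrite -mulr_sumr ler_wpM2l// -[leRHS]div1r ler_pdivlMr//.
  rewrite big_mkord mulrC -[leLHS]opprK -mulNr opprB -subrX1 opprB.
  by rewrite lerBlDr lerDl exprn_ge0.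
exists (lim_sup_set A); split.
- by apply: bigcap_measurable => // k _; apply: bigcup_measurable => j _; exact: mA.
- exact: lim_sup_set_cvg0.
- move=> w /= Hw k _; apply: contrapT => Hk; apply: Hw.
  exists k => // n /= kn An; apply: Hk; by exists n.
Qed.

End probability_tools.

(** * Tails of the partition function at fixed size *)

Lemma measurable_le_set d (T : measurableType d) (R : realType) (f g : T -> R) :
  measurable_fun setT f -> measurable_fun setT g ->
  measurable [set w | f w <= g w].
Proof.
move=> mf mg.
have /(_ measurableT [set true]) := measurable_fun_ler mf mg.
by rewrite setTI preimage_true; apply.
Qed.

Section moments.
Context d (T : measurableType d) (R : realType) (P : probability T R).
Variables (a h : R) (N : nat) (xi : config N -> {RV P >-> R}).
Hypothesis N0 : (0 < N)%N.
Hypothesis xiP : iid_normal 0 (N%:R^-1) xi.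
Implicit Types b c p : R.

Local Notation H w s := (hamiltonian a h (fun s : config N => xi s w) s).
Local Notation Z b w := (partition_function a h (fun s : config N => xi s w) b).
Local Notation f := (annealed a h).

Let n0 : 0 < N%:R :> R. Proof. by rewrite ltr0n. Qed.

Lemma measurable_hamiltonian s : measurable_fun setT (fun w => H w s).
Proof.
apply: measurable_funD => //; apply: measurable_funM => //.
Qed.

Lemma measurable_partition_function b : measurable_fun setT (fun w => Z b w).
Proof.
apply: measurable_sum => s; apply: measurableT_comp => //.
apply: measurableT_comp => //; apply: measurable_funM => //.
exact: measurable_hamiltonian.
Qed.

Lemma partition_function_ge0 b w : 0 <= Z b w.
Proof. by apply: sumr_ge0 => s _; exact: expR_ge0. Qed.

(** The logarithm of the mean of [exp (c - b H_N(s))], see [boltzmann_mean].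
    The shift [c] is the logarithm of a factor in front of [Z_N]. *)
Definition boltzmann_exponent b c (s : config N) : R :=
  c + N%:R * (b ^+ 2 * a ^+ 2 / 2) - b * h * \sum_(i < N) spin s i.

Lemma boltzmann_mean b c (s : config N) :
  (\int[P]_w (expR (c - b * H w s))%:E = (expR (boltzmann_exponent b c s))%:E)%E.
Proof.
have s0 : Num.sqrt (N%:R^-1 : R) != 0 by rewrite gt_eqF// sqrtr_gt0 invr_gt0.
have mgf := normal_mgf (- (b * a * N%:R)) s0 (xiP.2 s).
pose k := c - b * h * \sum_(i < N) spin s i.
transitivity (\int[P]_w ((expR k)%:E *
    (expR (- (b * a * N%:R) * xi s w))%:E))%E.
  apply: eq_integral => w _; rewrite -EFinM -expRD; congr (expR _)%:E.
  by rewrite /hamiltonian /k; ring.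
rewrite ge0_integralZl//; last first.
  by apply/measurable_EFinP; apply: measurableT_comp => //; exact: measurable_funM.
rewrite mgf sqr_sqrtr ?invr_ge0// -EFinM -expRD; congr (expR _)%:E.
by rewrite /k /boltzmann_exponent; field; rewrite gt_eqF.
Qed.

(** The sum over configurations factorizes over spins, each giving
    [2 cosh (b h)]. *)
Lemma sum_boltzmann_exponent b c :
  \sum_(s : config N) expR (boltzmann_exponent b c s) = expR (c + N%:R * f b).
Proof.
have e0 := cosh_gt0 (b * h).
transitivity (expR (c + N%:R * (b ^+ 2 * a ^+ 2 / 2)) *
    \sum_(s : config N) \prod_(i < N) expR (- (b * h) * (-1) ^+ s i)).
  rewrite mulr_sumr; apply: eq_bigr => s _.
  rewrite -expR_sum -mulr_sumr -expRD /boltzmann_exponent /spin.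
  by congr expR; rewrite mulNr.
rewrite -(bigA_distr_bigA (fun (_ : 'I_N) (e : bool) =>
  expR (- (b * h) * (-1) ^+ e) : R)).
rewrite prodr_const card_ord big_bool/= expr0 expr1 mulrN1 opprK mulr1.
have -> : expR (b * h) + expR (- (b * h)) = expR (ln 2 + ln (cosh (b * h))).
  by rewrite expRD !lnK ?posrE// /cosh; field.
by rewrite -expRM_natl -expRD; congr expR; rewrite /annealed; ring.
Qed.

Lemma partition_function_mean b :
  (\int[P]_w (Z b w)%:E = (expR (N%:R * f b))%:E)%E.
Proof.
transitivity (\sum_(s : config N) \int[P]_w (expR (0 - b * H w s))%:E)%E.
  rewrite -ge0_integral_sum//.
  - apply: eq_integral => w _; rewrite sumEFin; congr (_%:E).
    by apply: eq_bigr => s _; rewrite sub0r.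
  - move=> s; apply/measurable_EFinP; apply: measurableT_comp => //.
    apply: measurable_funB => //; apply: measurable_funM => //.
    exact: measurable_hamiltonian.
under eq_bigr do rewrite boltzmann_mean.
by rewrite sumEFin sum_boltzmann_exponent add0r.
Qed.

Lemma partition_function_upper_tail b e :
  (P [set w | (expR (N%:R * (f b + e)) <= Z b w)%R] <= (expR (- e) ^+ N)%:E)%E.
Proof.
have mZ := measurable_partition_function b.
have mean : (\int[P]_w (Z b w)%:E <= (expR (N%:R * f b))%:E)%E.
  by rewrite partition_function_mean.
have := markov_bound mZ (partition_function_ge0 b) (expR_gt0 _) mean.
move=> /(_ (N%:R * (f b + e))).
by rewrite -expRB mulrDr opprD addrA subrr add0r -mulrN expRM_natl.
Qed.

(** Bound on the Laplace transform of [Z_N] at [exp c] by its mean and by the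
    sum of the [p]-th moments of its terms, which is again the mean of a
    partition function, at inverse temperature [p * b]. By independence the
    transform is a product; each factor is at most [1 - m s + v s] by
    [expRN_le_power], hence at most [exp (- m s + v s)]. *)
Lemma partition_function_laplace b c p : 1 <= p <= 2 ->
  (\int[P]_w (expR (- (expR c * Z b w)))%:E <=
   (expR (- expR (c + N%:R * f b) + expR (p * c + N%:R * f (p * b))))%:E)%E.
Proof.
move=> p12.
pose g (s : config N) (x : R) :=
  expR (- expR (c - b * (a * N%:R * x + h * \sum_(i < N) spin s i))).
have mexpo k l s : measurable_fun setT (fun w => k - l * H w s).
  apply: measurable_funB => //; apply: measurable_funM => //.
  exact: measurable_hamiltonian.
have mg s : measurable_fun setT (g s).
  apply: measurableT_comp => //; apply: measurableT_comp => //.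
  apply: measurableT_comp => //; apply: measurable_funB => //.
  apply: measurable_funM => //; exact: measurable_funD.
have mgxi s : measurable_fun setT (fun w => g s (xi s w)).
  exact: measurableT_comp.
have g0 s x : 0 <= g s x by exact: expR_ge0.
have g1 s x : g s x <= 1 by rewrite expR_le1 oppr_le0 expR_ge0.
pose m s := expR (boltzmann_exponent b c s).
pose v s := expR (boltzmann_exponent (p * b) (p * c) s).
have moments s : (\int[P]_w (g s (xi s w))%:E + (m s)%:E <= (1 + v s)%:E)%E.
  have mexp k l : measurable_fun setT (fun w => (expR (k - l * H w s))%:E).
    by apply/measurable_EFinP; exact: measurableT_comp.
  have exp0 k l w : (0 <= (expR (k - l * H w s))%:E)%E.
    by rewrite lee_fin expR_ge0.
  have mgE : measurable_fun setT (fun w => (g s (xi s w))%:E).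
    exact/measurable_EFinP.
  have gE0 w : (0 <= (g s (xi s w))%:E)%E by rewrite lee_fin.
  have <- : (\int[P]_w (expR (c - b * H w s))%:E = (m s)%:E)%E.
    exact: boltzmann_mean.
  have -> : ((1 + v s)%:E =
      \int[P]_w (1 + (expR (p * c - p * b * H w s))%:E))%E.
    rewrite ge0_integralD//.
    rewrite boltzmann_mean EFinD; congr (_ + _)%E.
    by rewrite integral_cst// mul1e; apply/esym/probability_setT.
  rewrite -ge0_integralD//; apply: ge0_le_integral => //.
  - by move=> w _; exact: adde_ge0.
  - exact: emeasurable_funD.
  - by apply: emeasurable_funD => //; exact: measurable_cst.
  - move=> w _; rewrite -!EFinD lee_fin -mulrA -mulrBr.
    exact: expRN_le_power.
pose q s := fine (\int[P]_w (g s (xi s w))%:E).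
have qE s : (\int[P]_w (g s (xi s w))%:E = (q s)%:E)%E.
  rewrite fineK// ge0_fin_numE; last first.
    by apply: integral_ge0 => w _; rewrite lee_fin.
  apply: le_lt_trans (ltry (1 + v s)); apply: le_trans (moments s).
  by rewrite leeDl// lee_fin expR_ge0.
have q0 s : 0 <= q s by apply/fine_ge0/integral_ge0 => w _; rewrite lee_fin.
have q_le s : q s <= expR (- m s + v s).
  have := moments s; rewrite qE -EFinD lee_fin => qmv.
  by apply: le_trans (expR_ge1Dx _); lra.
have -> : (\int[P]_w (expR (- (expR c * Z b w)))%:E =
    \int[P]_w (\prod_s g s (xi s w))%:E)%E.
  apply: eq_integral => w _; congr (_%:E).
  rewrite -expR_sum mulr_sumr -sumrN; congr expR; apply: eq_bigr => s _.
  by rewrite -expRD.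
rewrite (expectation_prod (proj1 xiP))//; last first.
  by move=> s x; rewrite g0 g1.
under eq_bigr do rewrite qE.
rewrite prodEFin lee_fin -!sum_boltzmann_exponent -sumrN -big_split/= expR_sum.
by apply: ler_prod => s _; rewrite q0 q_le.
Qed.

(** Chernoff bound for the lower tail. The Laplace parameter [exp c] is
    [exp (N eta) / E Z_N]: then the mean contributes [- exp (N eta)] to the
    exponent, the [p]-th moments at most [1], and the threshold at most
    [1]. *)
Lemma partition_function_lower_tail b e eta p : 1 <= p <= 2 -> 0 <= eta <= e ->
    2 * eta <= p * f b - f (p * b) ->
  (P [set w | (Z b w <= expR (N%:R * (f b - e)))%R] <=
   (expR 2 * expR (- eta) ^+ N)%:E)%E.
Proof.
move=> p12 /andP[eta0 etae] gap.
pose c := N%:R * (eta - f b).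
pose Y w := expR (- (expR c * Z b w)).
have mY : measurable_fun setT Y.
  apply: measurableT_comp => //; apply: measurableT_comp => //.
  by apply: measurable_funM => //; exact: measurable_partition_function.
have Y0 w : 0 <= Y w by exact: expR_ge0.
have := markov_bound mY Y0 (expR_gt0 (-1)) (partition_function_laplace b c p12).
move=> B; apply: le_trans (le_trans _ B) _.
- apply: le_measure; rewrite ?inE.
  + by apply: measurable_le_set => //; exact: measurable_partition_function.
  + exact: measurable_le_set.
  move=> w /= Zle; rewrite ler_expR lerN2.
  have := ler_wpM2l (expR_ge0 c) Zle => /le_trans; apply.
  rewrite -expRD -[leRHS]expR0 ler_expR /c -mulrDr mulr_ge0_le0//.
  lra.
- rewrite lee_fin -expRB -expRM_natl -expRD ler_expR.
  have -> : c + N%:R * f b = N%:R * eta by rewrite /c; ring.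
  have : expR (p * c + N%:R * f (p * b)) <= 1.
    rewrite expR_le1 (_ : _ + _ = N%:R * (p * eta - (p * f b - f (p * b)))).
      rewrite mulr_ge0_le0// subr_le0 (le_trans _ gap)// ler_wpM2r//.
      by case/andP: p12.
    by rewrite /c; ring.
  have := expR_ge1Dx (N%:R * eta); lra.
Qed.

End moments.

(** * Almost sure limits *)

Lemma partition_functionE (R : realType) (a h : R) (N : nat) (x : config N -> R)
    (b : R) :
  partition_function a h x b = gibbs_sum (fun s => - hamiltonian a h x s) b.
Proof. by apply: eq_bigr => s _; rewrite mulrN. Qed.

Lemma ae_cvg d (T : measurableType d) (R : realType) (P : probability T R)
    (F : nat -> T -> R) (l : R) :
  (forall e, 0 < e ->
    {ae P, forall w, \forall n \near \oo, l - e <= F n w <= l + e}) ->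
  {ae P, forall w, F n w @[n --> \oo] --> l}.
Proof.
move=> FP; have e0 k : 0 < k.+1%:R^-1 :> R by rewrite invr_gt0.
apply: filterS (ae_foralln (fun k => FP _ (e0 k))) => w Fw.
apply/cvgrPdist_le => e epos.
have [k ke] : exists k : nat, k.+1%:R^-1 <= e.
  exists (Num.trunc e^-1).
  rewrite -[leRHS]invrK lef_pV2 ?posrE ?invr_gt0//.
  by rewrite ltW// truncnS_gt.
apply: filterS (Fw k) => n /andP[F1 F2].
rewrite ler_distlC; apply/andP; split.
  by apply: le_trans F1; rewrite lerD2l lerN2.
by apply: le_trans F2 _; rewrite lerD2l.
Qed.

Section free_energy_bounds.
Context d (T : measurableType d) (R : realType) (P : probability T R).
Variables (a h : R) (xi : forall N : nat, config N -> {RV P >-> R}).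
Hypotheses (a0 : 0 < a) (h0 : 0 < h).
Hypothesis xiP : forall N : nat, (0 < N)%N -> iid_normal 0 (N%:R^-1) (@xi N).
Implicit Types b c e : R.

Local Notation Z N b w := (partition_function a h (fun s : config N => @xi N s w) b).
Local Notation F N b w := (N%:R^-1 * ln (Z N b w)).
Local Notation f := (annealed a h).
Local Notation m := (mean_energy a h).

Lemma partition_function_gt0 N b w : 0 < Z N b w.
Proof. by rewrite partition_functionE (gibbs_sum_gt0 _ [ffun=> true]). Qed.

(** Markov's inequality for [Z_N], then Borel-Cantelli. *)
Lemma free_energy_upper b e : 0 < e ->
  {ae P, forall w, \forall N \near \oo, F N b w <= f b + e}.
Proof.
move=> e0.
pose A N := [set w | expR (N%:R * (f b + e)) <= Z N b w].
have mA N : measurable (A N).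
  by apply: measurable_le_set => //; exact: measurable_partition_function.
have r01 : 0 <= expR (- e) < 1 by rewrite expR_ge0 expR_lt1 oppr_lt0.
have PA N : (P (A N) <= (1 * expR (- e) ^+ N)%:E)%E.
  case: N => [|N]; first by rewrite expr0 mulr1; exact: probability_le1.
  by rewrite mul1r; apply: partition_function_upper_tail => //; exact: xiP.
apply: filterS (borel_cantelli_geometric r01 mA PA) => w Aw.
near=> N; have N0 : 0 < N%:R :> R by rewrite ltr0n; near: N; exists 1%N.
have /negP : ~ A N w by near: N.
rewrite -ltNge => ZN; rewrite ler_pdivrMl// -ler_expR.
by rewrite lnK ?posrE ?partition_function_gt0// ltW.
Unshelve. all: by end_near. Qed.

(** Below the critical point [annealed b / b] is still decreasing, so
    [p * annealed b - annealed (p * b) > 0] for some [p] in [(1, 2]], namely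
    any [p] with [p * b <= bc]. This makes the [p]-th moments negligible in
    [partition_function_lower_tail]. *)
Lemma free_energy_lower b bc e : critical a h bc -> 0 < b -> b < bc -> 0 < e ->
  {ae P, forall w, \forall N \near \oo, f b - e <= F N b w}.
Proof.
move=> bcP b0 bbc e0.
pose p := Num.min 2 (bc / b).
have p1 : 1 < p by rewrite lt_min ltr1n ltr_pdivlMr// mul1r.
have p2 : p <= 2 by rewrite ge_min lexx.
have pb : p * b <= bc by rewrite -ler_pdivlMr// ge_min lexx orbT.
have gap : 0 < p * f b - f (p * b).
  have bpb : b < p * b by rewrite ltr_pMl.
  have pb0 : 0 <= p * b by rewrite ltW// (lt_trans b0).
  have := annealed_ratio_decreasing a0 b0 bpb (high_temperature a0 h0 bcP pb0 pb).
  by rewrite -mulrA mulrCA ltr_pM2l// -subr_gt0.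
pose eta := Num.min e ((p * f b - f (p * b)) / 2).
have eta0 : 0 < eta by rewrite lt_min e0 divr_gt0.
have etae : 0 <= eta <= e by rewrite (ltW eta0) ge_min lexx.
have eta_gap : 2 * eta <= p * f b - f (p * b).
  by rewrite mulrC -ler_pdivlMr// ge_min lexx orbT.
pose A N := [set w | Z N b w <= expR (N%:R * (f b - e))].
have mA N : measurable (A N).
  by apply: measurable_le_set => //; exact: measurable_partition_function.
have r01 : 0 <= expR (- eta) < 1 by rewrite expR_ge0 expR_lt1 oppr_lt0.
have p12 : 1 <= p <= 2 by rewrite (ltW p1).
have PA N : (P (A N) <= (expR 2 * expR (- eta) ^+ N)%:E)%E.
  case: N => [|N].
    rewrite expr0 mulr1; apply: (le_trans (probability_le1 P (mA 0%N))).
    by rewrite lee_fin -[leLHS]expR0 ler_expR.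
  by apply: partition_function_lower_tail p12 etae eta_gap => //; exact: xiP.
apply: filterS (borel_cantelli_geometric r01 mA PA) => w Aw.
near=> N; have N0 : 0 < N%:R :> R by rewrite ltr0n; near: N; exists 1%N.
have /negP : ~ A N w by near: N.
rewrite -ltNge => ZN; rewrite ler_pdivlMl// -ler_expR.
by rewrite lnK ?posrE ?partition_function_gt0// ltW.
Unshelve. all: by end_near. Qed.

(** The scaling bound [ln_gibbs_sum_scale] carries the estimate from the
    critical point to [b], and [annealed bc / bc = mean_energy bc]. *)
Lemma free_energy_upper_frozen b bc e : critical a h bc -> bc <= b -> 0 < e ->
  {ae P, forall w, \forall N \near \oo, F N b w <= b * m bc + e}.
Proof.
move=> bcP bcb e0; have bc0 := bcP.1; have b0 := lt_le_trans bc0 bcb.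
have e'0 : 0 < bc / b * e by rewrite mulr_gt0// divr_gt0.
apply: filterS (free_energy_upper bc e'0) => w; apply: filterS => N FN.
rewrite -(ler_pM2l bc0) mulrCA.
have : N%:R^-1 * (bc * ln (Z N b w)) <= N%:R^-1 * (b * ln (Z N bc w)).
  rewrite ler_wpM2l ?invr_ge0// !partition_functionE.
  exact: (ln_gibbs_sum_scale _ [ffun=> true]).
move/le_trans; apply; rewrite mulrCA.
apply: (le_trans (ler_wpM2l (ltW b0) FN)).
rewrite -(critical_mean_energy bcP) le_eqVlt; apply/orP; left; apply/eqP.
by field; rewrite gt_eqF.
Qed.

(** By convexity of the log-partition function, the chord through two points
    [b1 < b2] below the critical point, where the limit is known, bounds the
    free energy at [b] from below. In the limit the chord dominates the
    tangent line [G b1] to [annealed] at [b1], and [G b1] tends to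
    [b * mean_energy bc] as [b1] tends to [bc]. *)
Lemma free_energy_lower_frozen b bc e : critical a h bc -> bc <= b -> 0 < e ->
  {ae P, forall w, \forall N \near \oo, b * m bc - e <= F N b w}.
Proof.
move=> bcP bcb e0; have bc0 := bcP.1.
pose G b1 := f b1 + (b - b1) * m b1.
have GbcE : G bc = b * m bc.
  by rewrite /G -(critical_mean_energy bcP) -mulrDl addrC subrK.
have Gcvg : G b1 @[b1 --> bc] --> G bc.
  apply: cvgD; first exact: continuous_annealed.
  apply: cvgM; last exact: continuous_mean_energy.
  by apply: cvgB; [exact: cvg_cst|exact: cvg_id].
have [b1 [b10 b1bc Gb1]] :
    exists b1, [/\ 0 < b1, b1 < bc & b * m bc - e / 2 <= G b1].
  have e20 : 0 < e / 2 by rewrite divr_gt0.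
  near bc^'- => b1; exists b1; split.
  - near: b1; exact: nbhs_left_gt.
  - near: b1; exact: nbhs_left_lt.
  - have : `|G bc - G b1| <= e / 2.
      near: b1; apply: cvg_within.
      by move/cvgrPdist_le : Gcvg => /(_ _ e20).
    by rewrite GbcE ler_distlC => /andP[].
pose b2 := (b1 + bc) / 2.
have [b12 b2bc] : b1 < b2 /\ b2 < bc by rewrite /b2; split; lra.
pose D := b2 - b1; pose S := b - b2.
have D0 : 0 < D by rewrite subr_gt0.
have S0 : 0 <= S by rewrite subr_ge0; lra.
(* the chord amplifies errors at b1 and b2 by at most (D + 2 S) / D *)
pose e' := D * e / (2 * (D + 2 * S)).
have DS0 : 0 < D + 2 * S by lra.
have e'0 : 0 < e' by rewrite divr_gt0 ?mulr_gt0.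
have e'E : e' * (D + 2 * S) = D * e / 2 by rewrite /e'; field; rewrite gt_eqF.
apply: filterS2 (free_energy_upper b1 e'0)
  (free_energy_lower bcP (lt_trans b10 b12) b2bc e'0) => w.
apply: filterS2 => N F1 F2.
have conv : S * (F N b2 w - F N b1 w) <= D * (F N b w - F N b2 w).
  rewrite -!mulrBr ![_ * (N%:R^-1 * _)]mulrCA ler_wpM2l ?invr_ge0//.
  rewrite !partition_functionE.
  apply: (ln_gibbs_sum_convex _ [ffun=> true]) => //; lra.
have tang : f b1 + D * m b1 <= f b2.
  by apply/ltW/annealed_tangent => //; rewrite lt_eqF.
have SF : S * (f b2 - f b1 - 2 * e') <= S * (F N b2 w - F N b1 w).
  by apply: ler_wpM2l => //; lra.
have ST : S * (D * m b1) <= S * (f b2 - f b1) by apply: ler_wpM2l => //; lra.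
have DT : D * (f b1 + D * m b1) <= D * f b2 by rewrite ler_pM2l.
have DF : D * (f b2 - e') <= D * F N b2 w by rewrite ler_pM2l.
have DG : D * (b * m bc - e / 2) <= D * G b1 by rewrite ler_pM2l.
have GE : G b1 = f b1 + (D + S) * m b1 by rewrite /G /D /S; ring.
rewrite GE in DG.
rewrite -(ler_pM2l D0); lra.
Unshelve. all: by end_near. Qed.

End free_energy_bounds.

Theorem theorem4p4p1 (R : realType) (d : measure_display)
    (T : measurableType d) (P : probability T R)
    (a h beta : R)
    (xi : forall N : nat, config N -> {RV P >-> R}) :
  0 < a -> 0 < h -> 0 < beta ->
  (forall N : nat, (0 < N)%N -> iid_normal 0 (N%:R^-1) (xi N)) ->
  [/\ exists! y0 : R, is_y0 a h y0,
      beta <= beta_threshold a -> exists! c : R, is_cbeta a beta c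
    & forall y0 c : R,
        is_y0 a h y0 ->
        (beta <= beta_threshold a -> is_cbeta a beta c) ->
        {ae P, forall w : T,
          N%:R^-1 * ln (partition_function a h (fun s : config N => xi N s w) beta)
            @[N --> \oo] --> limiting_free_energy a h beta y0 c}].
Proof.
move=> a0 h0 beta0 xiP; split.
- exact: is_y0_exists_unique.
- exact: is_cbeta_exists_unique.
move=> y0 c y0P cP.
have [bc bcP ->] := limiting_free_energyE a0 h0 beta0 y0P cP.
apply: ae_cvg => e e0.
have [bbc|bcb] := ltP beta bc.
  rewrite (ltW bbc).
  apply: filterS2 (free_energy_upper a h xiP beta e0)
    (free_energy_lower a0 h0 xiP bcP beta0 bbc e0) => w.
  by apply: filterS2 => N -> ->.
(* both branches agree at beta = bc *)
have -> : (if beta <= bc then annealed a h beta else beta * mean_energy a h bc)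
    = beta * mean_energy a h bc.
  case: ifPn => // bbc; have -> : beta = bc by apply: le_anti; rewrite bbc.
  by rewrite critical_mean_energy.
apply: filterS2 (free_energy_upper_frozen xiP bcP bcb e0)
  (free_energy_lower_frozen a0 h0 xiP bcP bcb e0) => w.
by apply: filterS2 => N -> ->.
Qed.
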